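(* Assume the initial network cost is less than or equal to $D^0<\infty$. At each iteration of the power control algorithm (described in the context), $H_{\boldsymbol\gamma}^{k,\lambda}=\nabla^2D(\boldsymbol\gamma)\big|_{\lambda\boldsymbol\gamma^k+(1-\lambda)\boldsymbol\gamma^{k+1}}$ is upper bounded by the diagonal matrix $$\bar V=|\mathcal N||\mathcal E|\left[\bar B(D^0)\kappa+\underline B(D^0)\varphi\right]\mathrm{diag}\left\{(\bar S_i^2)_{i\in\mathcal N}\right\}$$ for all $\lambda\in[0,1]$, in the sense that for all $\boldsymbol v\in\mathbb R^{|\mathcal N|}$, $\boldsymbol v'\cdot H_{\boldsymbol\gamma}^{k,\lambda}\cdot\boldsymbol v\le\boldsymbol v'\cdot\bar V\cdot\boldsymbol v$.
   Context: $(\mathcal N,\mathcal E)$ is a finite directed graph, $\mathcal O(i)=\{j:(i,j)\in\mathcal E\}$. Network cost $D=\sum_{(i,j)\in\mathcal E}D_{ij}(C_{ij},F_{ij})$; with $\mathcal X=\{(C,F):0\le F<C\}$, each $D_{ij}$ is nonnegative and twice continuously differentiable on $\mathcal X$, with $\partial D_{ij}/\partial C_{ij}<0$, $\partial D_{ij}/\partial F_{ij}>0$, $\partial^2D_{ij}/\partial C_{ij}^2\ge0$, $\partial^2D_{ij}/\partial F_{ij}^2\ge0$; $D_{ij}\to\infty$ as $F_{ij}\to C_{ij}^-$, and $D_{ij}=\infty$ outside $\mathcal X$. Node $i$ has power limit $\bar P_i>1$, $\bar S_i=\ln\bar P_i$; $P_i=(\bar P_i)^{\gamma_i}$ with $\gamma_i\le1$;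 $P_{ij}=P_i\eta_{ij}$ with $\eta_{ij}\ge0$, $\sum_{j\in\mathcal O(i)}\eta_{ij}=1$. $N_j$ are noise powers, $G_{mj}$ constant path gains. $$IN_{ij}=G_{ij}P_i(1-\eta_{ij})+\sum_{m\ne i}G_{mj}P_m+N_j,\quad x_{ij}=SINR_{ij}=\frac{G_{ij}P_{ij}}{IN_{ij}},\quad C_{ij}=C(x_{ij}),$$ where $C(\cdot)$ is strictly increasing, concave, twice continuously differentiable on $(0,\infty)$, with $C''(x)x+C'(x)\le0$. $D(\boldsymbol\gamma)$ is the network cost as a function of $\boldsymbol\gamma=(\gamma_i)_{i\in\mathcal N}$, the flows $F_{ij}$ and allocations $\eta_{ij}$ being fixed. Quantities: $\bar B(D^0)=\max_{(m,n)\in\mathcal E}\max_{D_{mn}\le D^0}\frac{\partial^2D_{mn}}{\partial C_{mn}^2}$, $\underline B(D^0)=\min_{(m,n)\in\mathcal E}\min_{D_{mn}\le D^0}\frac{\partial D_{mn}}{\partial C_{mn}}$; $\bar x$ is a finite upper bound on the SINR achievable on all links under the power constraints $P_i\le\bar P_i$; $\kappa=\max_{0\le x\le\bar x}C'(x)^2x^2$; $\varphi=\min_{0\le x\le\bar x}C''(x)x^2$. Power control algorithm: $\boldsymbol\gamma^{k+1}$ minimizes $\delta{\boldsymbol\gamma^k}'(\boldsymbol\gamma-\boldsymbol\gamma^k)+\frac12(\boldsymbol\gamma-\boldsymbol\gamma^k)'V^k(\boldsymbol\gamma-\boldsymbol\gamma^k)$ over $\boldsymbol\gamma\le\mathbf1$,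 where $\delta\boldsymbol\gamma=(\delta\gamma_i)_{i\in\mathcal N}$, $\delta\gamma_i=\frac1{\bar S_i}\frac{\partial D}{\partial\gamma_i}$, and the scaling matrix $V^k$ is symmetric and positive definite on $\mathbb R^{|\mathcal N|}$.
   Formalization: The formal statement additionally assumes that the network costs at γ^k and at γ^{k+1} do not exceed the initial network cost; for an arbitrary positive definite V^k an iteration can overshoot to infinite cost and the bound fails. *)

(* Defs.v *)
(* MathComp-Analysis *)
From HB Require Import structures.
From mathcomp Require Import all_boot all_order all_algebra.
From mathcomp Require Import all_classical all_reals all_analysis.

Set Implicit Arguments.
Unset Strict Implicit.
Unset Printing Implicit Defensive.

Import Order.TTheory GRing.Theory Num.Theory.
Import numFieldNormedType.Exports.

Local Open Scope classical_set_scope.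
Local Open Scope ring_scope.

Section PlaneCalculus.
Context {R : realType}.
Implicit Types (f : R * R -> R) (p : R * R).

(* A point of the plane is (capacity, flow). *)
Definition dC f : R * R -> R := 'D_((1, 0) : R * R) f.
Definition dF f : R * R -> R := 'D_((0, 1) : R * R) f.

Definition C1_on (U : set (R * R)) f : Prop :=
  forall p, U p ->
    [/\ derivable f p (1, 0), derivable f p (0, 1),
        {for p, continuous (dC f)} & {for p, continuous (dF f)}].

Definition C2_on (U : set (R * R)) f : Prop :=
  [/\ C1_on U f, C1_on U (dC f) & C1_on U (dF f)].

Definition feasible : set (R * R) := [set p | 0 <= p.2 < p.1].

(* [feasible] contains its edge F = 0, so smoothness on it is smoothness on an
   open neighbourhood; the partial derivatives at F = 0 are then determined by
   the values of [d] on [feasible]. *)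
Record link_cost (d : R * R -> R) : Prop := LinkCost {
  link_cost_ge0 : forall p, feasible p -> 0 <= d p;
  link_cost_C2 : exists U : set (R * R),
    [/\ open U, feasible `<=` U & C2_on U d];
  link_cost_dC : forall p, feasible p -> dC d p < 0;
  link_cost_dF : forall p, feasible p -> 0 < dF d p;
  link_cost_dCC : forall p, feasible p -> 0 <= dC (dC d) p;
  link_cost_dFF : forall p, feasible p -> 0 <= dF (dF d) p;
  link_cost_blowup : forall c : R, 0 < c -> d (c, f) @[f --> c^'-] --> +oo
}.

Definition ext_cost (d : R * R -> R) p : \bar R :=
  if p \in feasible then (d p)%:E else +oo%E.

(* Nothing is required of [cap] outside ]0, +oo[: the value at 0 is -oo for the
   typical capacity ln (K x). *)
Record capacity (cap : R -> R) : Prop := Capacity {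
  capacity_incr : forall x y : R, 0 < x -> x < y -> cap x < cap y;
  capacity_concave : @convex_function R R^o [set x | 0 < x] (fun x => - cap x);
  capacity_C2 : forall x : R, 0 < x ->
    [/\ derivable cap x 1, derivable (derive1 cap) x 1
      & {for x, continuous (derive1 (derive1 cap))}];
  capacity_elastic : forall x : R, 0 < x -> derive1 (derive1 cap) x * x + derive1 cap x <= 0
}.

End PlaneCalculus.

(* Nodes are the elements of 'I_n; [gain m j] is the path gain from m to j. *)
Record network (R : realType) (n : nat) := Network {
  edge : rel 'I_n;
  gain : 'I_n -> 'I_n -> R;
  noise : 'I_n -> R;
  pmax : 'I_n -> R;
  cap : R -> R;
  lcost : 'I_n -> 'I_n -> R * R -> R
}.

Section Network.
Context {R : realType} {n : nat}.
Variable net : network R n.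
Implicit Types (P : 'I_n -> R) (eta F : 'I_n -> 'I_n -> R).
Implicit Types (gamma : 'cV[R]_n).

Record network_axioms : Prop := NetworkAxioms {
  gain_ge0 : forall m j, 0 <= gain net m j;
  noise_gt0 : forall j, 0 < noise net j;
  pmax_gt1 : forall i, 1 < pmax net i;
  cap_axioms : capacity (cap net);
  lcost_axioms : forall i j, edge net i j -> link_cost (lcost net i j)
}.

Definition edge_set : {set 'I_n * 'I_n} := [set e | edge net e.1 e.2].

(* The normalisation is imposed at nodes that have an outgoing link; at the
   others it would be the absurd 0 = 1. *)
Definition allocation eta : Prop :=
  (forall i j, edge net i j -> 0 <= eta i j) /\
  (forall i, (exists j, edge net i j) -> \sum_(j | edge net i j) eta i j = 1).

Definition interference P eta i j : R :=
  gain net i j * P i * (1 - eta i j) + \sum_(m | m != i) gain net m j * P m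
  + noise net j.

Definition sinr P eta i j : R :=
  gain net i j * (P i * eta i j) / interference P eta i j.

Definition sinr_bound (xbar : R) : Prop :=
  forall P eta, (forall i, 0 <= P i <= pmax net i) -> allocation eta ->
  forall i j, edge net i j -> sinr P eta i j <= xbar.

Definition power gamma : 'I_n -> R := fun i => pmax net i `^ gamma i 0.

Definition log_pmax (i : 'I_n) : R := ln (pmax net i).

Definition network_cost eta F gamma : \bar R :=
  (\sum_(e in edge_set)
     ext_cost (lcost net e.1 e.2)
       (cap net (sinr (power gamma) eta e.1 e.2), F e.1 e.2))%E.

Definition partial (f : 'cV[R]_n -> R) (i : 'I_n) : 'cV[R]_n -> R :=
  'D_(delta_mx i 0 : 'cV[R]_n) f.

(* [fine] is harmless: the derivatives are taken at points around which the
   cost is finite. *)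
Definition hessian_cost eta F gamma : 'M[R]_n :=
  \matrix_(i, j) partial (partial (fine \o network_cost eta F) i) j gamma.

Definition scaled_gradient eta F gamma : 'cV[R]_n :=
  \col_i ((log_pmax i)^-1 * partial (fine \o network_cost eta F) i gamma).

Definition quad (A : 'M[R]_n) (v : 'cV[R]_n) : R := (v^T *m A *m v) 0 0.

Definition quad_model eta F (V : 'M[R]_n) gamma0 gamma : R :=
  ((scaled_gradient eta F gamma0)^T *m (gamma - gamma0)) 0 0
  + 2^-1 * quad V (gamma - gamma0).

Definition admissible gamma : Prop := forall i, gamma i 0 <= 1.

Definition power_control_step eta F (V : 'M[R]_n) gamma0 gamma1 : Prop :=
  admissible gamma1 /\
  forall gamma, admissible gamma ->
    quad_model eta F V gamma0 gamma1 <= quad_model eta F V gamma0 gamma.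

Definition sym_posdef (V : 'M[R]_n) : Prop :=
  V^T = V /\ forall v : 'cV[R]_n, v != 0 -> 0 < quad V v.

(* Values of a second-order quantity of the link costs, over all links and all
   (capacity, flow) pairs at which the cost of the link is at most D0. *)
Definition link_values (q : (R * R -> R) -> R * R -> R) (D0 : R) : set R :=
  [set y | exists i j p, [/\ edge net i j, feasible p,
     lcost net i j p <= D0 & y = q (lcost net i j) p]].

Definition dCC_values (D0 : R) : set R := link_values (fun d => dC (dC d)) D0.
Definition dC_values (D0 : R) : set R := link_values dC D0.

(* At x = 0 both expressions are 0 whatever the derivative there; as the first
   is nonnegative and the second nonpositive on ]0, xbar], this affects neither
   the supremum of the first nor the infimum of the second. *)
Definition kappa_values (xbar : R) : set R :=
  [set (derive1 (cap net) x) ^+ 2 * x ^+ 2 | x in `[0, xbar]].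
Definition phi_values (xbar : R) : set R :=
  [set derive1 (derive1 (cap net)) x * x ^+ 2 | x in `[0, xbar]].

Definition Bmax (D0 : R) : R := sup (dCC_values D0).
Definition Bmin (D0 : R) : R := inf (dC_values D0).
Definition kappa (xbar : R) : R := sup (kappa_values xbar).
Definition phi (xbar : R) : R := inf (phi_values xbar).

(* [sup] and [inf] are 0 on unbounded sets: this says that the four extrema
   are genuine. *)
Definition finite_extrema (D0 xbar : R) : Prop :=
  [/\ has_ubound (dCC_values D0), has_lbound (dC_values D0),
      has_ubound (kappa_values xbar) & has_lbound (phi_values xbar)].

Definition Vbar (D0 xbar : R) : 'M[R]_n :=
  (#|'I_n|%:R * #|edge_set|%:R
     * (Bmax D0 * kappa xbar + Bmin D0 * phi xbar))
  *: diag_mx (\row_i log_pmax i ^+ 2).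

End Network.

(* Main.v *)
Require Import Defs.
From HB Require Import structures.
From mathcomp Require Import all_boot all_order all_algebra.
From mathcomp Require Import all_classical all_reals all_analysis.
From mathcomp Require Import ring lra.

Set Implicit Arguments.
Unset Strict Implicit.
Unset Printing Implicit Defensive.

Import Order.TTheory GRing.Theory Num.Theory.
Import numFieldNormedType.Exports.

Local Open Scope classical_set_scope.
Local Open Scope ring_scope.

(* Write the cost of link (i, j) as L(y) with L(t) = D_ij(C(e^t), F_ij) and
   y = ln SINR_ij.  With u_m = S_m v_m and w_m the share of the power of node m
   in the interference (the w_m sum to less than 1), the derivative of y along v
   is p = u_i - sum_m w_m u_m and its second derivative is -q, where
   q = sum_m w_m u_m^2 - (sum_m w_m u_m)^2.  With X = C'(x) x and
   a = - C''(x) x^2 >= X >= 0, the link contributes to v' H v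
     D_CC X^2 p^2 + (- D_C) ((a - X) p^2 + X q),
   and p^2 and q are both at most n sum_m u_m^2.

   All links stay within the budget D0 on the segment between two iterates: the
   SINR is quasi-concave in gamma and D_ij is nonincreasing in the capacity, so
   the cost of a link is at most the larger of its values at the endpoints. *)

(** * Directional derivatives as derivatives of functions of one variable *)

Section DirectionalDerivatives.
Context {R : realType}.

(** Both sides have the same difference quotient. The chain rule for functions of one real variable
    thereby applies along any direction. *)
Lemma is_derive_line (V : normedModType R) (f : V -> R) (x v : V) (a : R) :
  is_derive x v f a <-> is_derive (0 : R) 1 (fun h : R => f (h *: v + x)) a.
Proof.
have E : (fun h : R => h^-1 *: ((f \o shift x) (h *: v) - f x)) =
    (fun h : R => h^-1 *: (((fun k : R => f (k *: v + x)) \o shift (0 : R)) (h *: 1)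
       - f ((0 : R) *: v + x))).
  by apply/funext => h /=; rewrite addr0 scale0r add0r [h *: 1]mulr1.
by split=> -[]; rewrite /derivable /derive ?E -?E => d1 d2; split; rewrite /derivable /derive ?E -?E.
Qed.

Lemma is_derive_comp_dir (V : normedModType R) (f : V -> R) (g : R -> R)
    (x v : V) (a b : R) :
  is_derive (f x) 1 g a -> is_derive x v f b -> is_derive x v (g \o f) (a * b).
Proof.
move=> dg /is_derive_line df; apply/is_derive_line.
apply: (@is_derive1_comp _ g (fun h : R => f (h *: v + x))) => //.
by rewrite scale0r add0r.
Qed.

Lemma is_derive_fst (d : R * R -> R) (c F a : R) :
  is_derive (c, F) ((1, 0) : R * R) d a <-> is_derive c 1 (fun c' => d (c', F)) a.
Proof.
apply: (iff_trans (is_derive_line _ _ _ _)).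
apply: (iff_trans _ (iff_sym (is_derive_line _ _ _ _))).
suff E : (fun h : R => d (h *: ((1, 0) : R * R) + (c, F))) =
    (fun h : R => d (h *: (1 : R) + c, F)).
  by split => D; [rewrite -E|rewrite E].
apply/funext => h; congr d; congr (_, _) => /=.
by rewrite [_ *: 0]mulr0 add0r.
Qed.

Lemma is_derive1E (f : R -> R) (x : R) :
  derivable f x 1 -> is_derive x 1 f (derive1 f x).
Proof. by move=> df; apply: DeriveDef => //; rewrite derive1E. Qed.

End DirectionalDerivatives.

(** * Calculus of Hessians: sums and compositions *)

Section Hessian.
Context {R : realType} {n : nat}.
Implicit Types (f : 'cV[R]_n -> R) (x z : 'cV[R]_n) (H : 'M[R]_n).

(** The gradient at [x] is kept next to the Hessian because the second-order chain rule needs both.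
    Only coordinate directions occur, as in [hessian_cost]. *)
Definition has_hessian f x (g : 'I_n -> R) H : Prop :=
  exists G : 'I_n -> 'cV[R]_n -> R,
    [/\ \forall z \near x, forall i, is_derive z (delta_mx i 0 : 'cV[R]_n) f (G i z),
        forall i, G i x = g i
      & forall i j, is_derive x (delta_mx j 0 : 'cV[R]_n) (G i) (H i j)].

(** A derivative at [x] depends only on the germ there, and [partial f i] agrees with [G i] near
    [x]. *)
Lemma has_hessianE f x g H :
  has_hessian f x g H -> \matrix_(i, j) partial (partial f i) j x = H.
Proof.
move=> [G [dG _ dH]]; apply/matrixP => i j; rewrite mxE.
have [_ <-] := dH i j; apply: near_eq_derive.
by apply: filterS dG => z /(_ i) [].
Qed.

Lemma has_hessian_near f f' x g H : (\forall z \near x, f z = f' z) ->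
  has_hessian f x g H -> has_hessian f' x g H.
Proof.
move=> ff' [G [dG gx dH]]; exists G; split=> //.
(* First derivatives are taken at points around [x], so the two functions must agree near each of
   those points, not only at them. *)
have {}ff' := near_join ff'.
by apply: filterS2 ff' dG => z fz dfz i; apply: near_eq_is_derive fz (dfz i).
Qed.

Lemma has_hessian_eq f x g H H' : has_hessian f x g H -> H = H' -> has_hessian f x g H'.
Proof. by move=> ? <-. Qed.

Lemma has_hessian_cst (c : R) x : has_hessian (fun=> c) x (fun=> 0) 0.
Proof.
exists (fun _ _ => 0); split=> //.
  by near=> z => i; apply: is_derive_cst.
by move=> i j; rewrite mxE; apply: is_derive_cst.
Unshelve. all: by end_near. Qed.

Lemma has_hessianD f1 f2 x g1 g2 H1 H2 :
  has_hessian f1 x g1 H1 -> has_hessian f2 x g2 H2 ->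
  has_hessian (fun z => f1 z + f2 z) x (fun i => g1 i + g2 i) (H1 + H2).
Proof.
move=> [G1 [dG1 gx1 dH1]] [G2 [dG2 gx2 dH2]].
exists (fun i z => G1 i z + G2 i z); split.
- by apply: filterS2 dG1 dG2 => z d1 d2 i; apply: is_deriveD (d1 i) (d2 i).
- by move=> i; rewrite gx1 gx2.
- by move=> i j; rewrite mxE; apply: is_deriveD (dH1 i j) (dH2 i j).
Qed.

Lemma has_hessian_sum (I : finType) (A : {set I}) (f : I -> 'cV[R]_n -> R) x
    (g : I -> 'I_n -> R) (H : I -> 'M[R]_n) :
  (forall e, e \in A -> has_hessian (f e) x (g e) (H e)) ->
  has_hessian (fun z => \sum_(e in A) f e z) x
    (fun i => \sum_(e in A) g e i) (\sum_(e in A) H e).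
Proof.
move=> fH; elim: (index_enum I) => [|e r IH].
  under eq_fun do rewrite big_nil; under [X in has_hessian _ _ X]eq_fun do rewrite big_nil.
  by rewrite big_nil; apply: has_hessian_cst.
under eq_fun do rewrite big_cons.
under [X in has_hessian _ _ X]eq_fun do rewrite big_cons.
rewrite big_cons; case: ifPn => // eA.
by apply: has_hessianD => //; apply: fH.
Qed.

(** Continuity of [f] pulls the neighbourhood of [f x] on which [L] is derivable back to one of [x];
    partial derivatives alone do not provide it. *)
Lemma has_hessian_comp f x g H (L L1 : R -> R) (L2 : R) :
  {for x, continuous f} -> has_hessian f x g H ->
  (\forall t \near f x, is_derive (t : R) (1 : R) L (L1 t)) ->
  is_derive (f x) 1 L1 L2 ->
  has_hessian (L \o f) x (fun i => L1 (f x) * g i)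
    (\matrix_(i, j) (L2 * (g i * g j) + L1 (f x) * H i j)).
Proof.
move=> cf [G [dG gx dH]] dL dL1.
exists (fun i z => L1 (f z) * G i z); split.
- have {}dL : \forall z \near x, is_derive (f z) 1 L (L1 (f z)) by exact: cf dL.
  apply: filterS2 dL dG => z dLz dfz i.
  exact: is_derive_comp_dir dLz (dfz i).
- by move=> i; rewrite gx.
- move=> i j; rewrite mxE.
  have df : is_derive x (delta_mx j 0 : 'cV[R]_n) f (g j).
    by rewrite -gx; move: j; apply: nbhs_singleton dG.
  have := is_deriveM (is_derive_comp_dir dL1 df) (dH i j).
  rewrite gx /=; move/is_derive_eq; apply.
  by rewrite /GRing.scale /=; ring.
Qed.

End Hessian.

(** * Quadratic forms and a Cauchy-Schwarz bound *)

Section QuadraticForms.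
Context {R : realType} {n : nat}.
Implicit Types (v : 'cV[R]_n) (A : 'M[R]_n).

Lemma quadE A v : quad A v = \sum_i \sum_j v i 0 * v j 0 * A i j.
Proof.
rewrite /quad mxE exchange_big /=; apply: eq_bigr => j _.
rewrite mxE big_distrl /=; apply: eq_bigr => i _.
by rewrite mxE; ring.
Qed.

Lemma quad_sum (I : finType) (P : {set I}) (H : I -> 'M[R]_n) v :
  quad (\sum_(e in P) H e) v = \sum_(e in P) quad (H e) v.
Proof.
by rewrite /quad mulmx_sumr mulmx_suml summxE.
Qed.

Lemma quad_scale_diag (c : R) (d : 'I_n -> R) v :
  quad (c *: diag_mx (\row_i d i)) v = c * \sum_i d i * v i 0 ^+ 2.
Proof.
rewrite quadE mulr_sumr; apply: eq_bigr => i _.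
rewrite (bigD1 i) //= big1 ?addr0 => [|j ji].
  by rewrite !mxE eqxx mulr1n; ring.
by rewrite !mxE eq_sym (negbTE ji) mulr0n !mulr0.
Qed.

Lemma sum_mul_sum (u w : 'I_n -> R) :
  \sum_i \sum_j u i * w j = (\sum_i u i) * (\sum_j w j).
Proof. by rewrite mulr_suml; apply: eq_bigr => i _; rewrite mulr_sumr. Qed.

(** Cauchy-Schwarz against the all-ones vector, obtained by summing 2 u_i u_j <= u_i^2 + u_j^2 over
    all pairs. *)
Lemma sqr_sum_le (u : 'I_n -> R) : (\sum_i u i) ^+ 2 <= n%:R * \sum_i u i ^+ 2.
Proof.
have two : 0 < 2 :> R by [].
rewrite -(ler_pM2l two) expr2 -sum_mul_sum.
have -> : 2 * (n%:R * \sum_i u i ^+ 2) = \sum_i \sum_j (u i ^+ 2 + u j ^+ 2).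
  under [RHS]eq_bigr do rewrite big_split /= sumr_const card_ord -mulr_natl.
  rewrite big_split /= sumr_const card_ord -mulr_sumr.
  by rewrite -[X in _ = _ + X]mulr_natl; ring.
rewrite mulr_sumr; apply: ler_sum => i _; rewrite mulr_sumr; apply: ler_sum => j _.
by have := sqr_ge0 (u i - u j); nra.
Qed.

End QuadraticForms.

(** * Derivatives of the log-SINR of a link out of node [i] *)

Section LogSinr.
Context {R : realType} {n : nat}.
Variables (b S : 'I_n -> R) (N lnG : R) (i : 'I_n).
Hypotheses (b_ge0 : forall m, 0 <= b m) (N_gt0 : 0 < N).
Implicit Types (z v : 'cV[R]_n).

(** With [S] the logarithms of the power limits, [expR (z m 0 * S m)] is the power of node [m]. The
    weights [b] will be the couplings of nodes to the link, and [lnG] the logarithm of gain times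
    allocation. *)
Definition received z : R := \sum_m b m * expR (z m 0 * S m) + N.
Definition share m z : R := b m * expR (z m 0 * S m) / received z.
Definition log_sinr z : R := lnG + z i 0 * S i - ln (received z).

Lemma received_gt0 z : 0 < received z.
Proof.
rewrite ltr_wpDl //; apply: sumr_ge0 => m _.
by rewrite mulr_ge0 // expR_ge0.
Qed.

Lemma share_ge0 m z : 0 <= share m z.
Proof. by rewrite divr_ge0 ?mulr_ge0 ?expR_ge0 // ltW // received_gt0. Qed.

(** The missing fraction is the share of the noise. *)
Lemma sum_share_le1 z : \sum_m share m z <= 1.
Proof. by rewrite -mulr_suml ler_pdivrMr ?received_gt0 // mul1r lerDl ltW. Qed.

Lemma share_le1 m z : share m z <= 1.
Proof.
apply: le_trans (sum_share_le1 z); rewrite (bigD1 m) //= lerDl.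
by apply: sumr_ge0 => l _; exact: share_ge0.
Qed.

Lemma is_derive_coord z (l m : 'I_n) :
  is_derive z (delta_mx l 0 : 'cV[R]_n) (fun z' => z' m 0) ((m == l)%:R : R).
Proof.
apply/is_derive_line.
under eq_fun => h do rewrite !mxE eqxx andbT.
have := is_deriveD (is_deriveM (is_derive_id (0 : R) 1) (is_derive_cst ((m == l)%:R : R) (0 : R) 1))
  (is_derive_cst (z m 0) (0 : R) 1).
move/is_derive_eq; apply.
by rewrite /GRing.scale /= !mulr0 mulr1 addr0 add0r.
Qed.

Lemma is_derive_received_term z (l m : 'I_n) :
  is_derive z (delta_mx l 0 : 'cV[R]_n) (fun z' => b m * expR (z' m 0 * S m))
    ((m == l)%:R * (b l * expR (z l 0 * S l) * S l)).
Proof.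
have d1 : is_derive z (delta_mx l 0 : 'cV[R]_n) (fun z' => z' m 0 * S m)
    ((m == l)%:R * S m).
  apply: is_derive_eq (is_deriveM (is_derive_coord z l m) (is_derive_cst (S m) _ _)) _.
  by rewrite /GRing.scale /=; ring.
have d2 := is_derive_comp_dir (f := fun z' => z' m 0 * S m) (is_derive_expR _) d1.
apply: is_derive_eq (is_deriveM (is_derive_cst (b m) _ _) d2) _.
have [->|_] := eqVneq m l; rewrite /GRing.scale /= ?mulr0n; ring.
Qed.

Lemma is_derive_received z (l : 'I_n) :
  is_derive z (delta_mx l 0 : 'cV[R]_n) received (b l * expR (z l 0 * S l) * S l).
Proof.
have -> : received = \sum_m (fun z' : 'cV[R]_n => b m * expR (z' m 0 * S m)) + cst N.
  by apply/funext => z'; rewrite /received /= fctE fct_sumE.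
apply: is_derive_eq (is_deriveD (is_derive_sum (is_derive_received_term z l))
  (is_derive_cst N _ _)) _.
rewrite addr0 (bigD1 l) //= eqxx mul1r big1 ?addr0 // => m /negbTE ->.
by rewrite mul0r.
Qed.

Lemma is_derive_log_sinr z (l : 'I_n) :
  is_derive z (delta_mx l 0 : 'cV[R]_n) log_sinr (S l * ((i == l)%:R - share l z)).
Proof.
have d1 := is_deriveM (is_derive_coord z l i)
  (is_derive_cst (S i) z (delta_mx l 0 : 'cV[R]_n)).
have d2 := is_derive_comp_dir (f := received) (is_derive1_ln (received_gt0 z)) (is_derive_received z l).
apply: is_derive_eq (is_deriveB (is_deriveD (is_derive_cst lnG _ _) d1) d2) _.
by rewrite /share; have [->|_] := eqVneq i l; rewrite /GRing.scale /= ?mulr0n; ring.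
Qed.

(** The shares form a softmax with an extra constant term in the denominator, whence the
    covariance-like derivative. *)
Lemma is_derive_share z (l m : 'I_n) :
  is_derive z (delta_mx m 0 : 'cV[R]_n) (share l)
    (S m * ((l == m)%:R * share l z - share l z * share m z)).
Proof.
have I0 : received z != 0 by rewrite gt_eqF // received_gt0.
have dV := is_derive_comp_dir (f := received) (is_deriveV (f := id) I0 (is_derive_id (received z) (1 : R))) (is_derive_received z m).
apply: is_derive_eq (is_deriveM (is_derive_received_term z m l) dV) _.
by rewrite /share; have [->|_] := eqVneq l m; rewrite /GRing.scale /= ?mulr0n; field.
Qed.

(** Continuity comes from Fréchet differentiability; it is the side condition of
    [has_hessian_comp]. *)
Lemma continuous_log_sinr : continuous log_sinr.
Proof.
move=> z; apply: differentiable_continuous.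
have dlin m : differentiable (fun z' : 'cV[R]_n => z' m 0 * S m) z.
  exact: (@differentiableZl R _ _ (fun z' : 'cV[R]_n => z' m 0) (S m) z
    (differentiable_coord _ _ _)).
have dR1 (g : R -> R) x : derivable g x 1 -> differentiable g x.
  by move/derivable1_diffP.
have dI : differentiable received z.
  have -> : received = \sum_m (fun z' : 'cV[R]_n => b m * expR (z' m 0 * S m)) + cst N.
    by apply/funext => z'; rewrite /received /= fctE fct_sumE.
  apply: differentiableD => //; apply: differentiable_sum => m.
  apply: (@differentiableZ R _ _ (fun z' : 'cV[R]_n => expR (z' m 0 * S m)) (b m)).
  by apply: (@differentiable_comp _ _ _ _ _ expR); [exact: dlin|apply: dR1].
apply: differentiableB; first by apply: differentiableD => //; exact: dlin.
apply: (@differentiable_comp _ _ _ _ received (@ln R)) => //; apply: dR1.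
by apply: ex_derive; exact/is_derive1_ln/received_gt0.
Qed.

Lemma has_hessian_log_sinr z :
  has_hessian log_sinr z (fun l => S l * ((i == l)%:R - share l z))
    (\matrix_(l, m) - (S l * S m * ((l == m)%:R * share l z - share l z * share m z))).
Proof.
exists (fun l z' => S l * ((i == l)%:R - share l z')); split=> //.
  by near=> z' => l; exact: is_derive_log_sinr.
move=> l m; rewrite mxE.
have := is_deriveM (is_derive_cst (S l) z (delta_mx m 0 : 'cV[R]_n))
  (is_deriveB (is_derive_cst ((i == l)%:R : R) z (delta_mx m 0 : 'cV[R]_n))
     (is_derive_share z l m)).
move/is_derive_eq; apply; rewrite /GRing.scale /=; ring.
Unshelve. all: by end_near. Qed.

(** The matrix is the one that [has_hessian_comp] produces for an outer function with second
    derivative [A] and first derivative [B] at the log-SINR. *)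
Lemma quad_log_sinr_comp (A B : R) z v :
  let p := \sum_l v l 0 * (S l * ((i == l)%:R - share l z)) in
  let q := \sum_l share l z * (S l * v l 0) ^+ 2
           - (\sum_l share l z * (S l * v l 0)) ^+ 2 in
  quad (\matrix_(l, m)
    (A * (S l * ((i == l)%:R - share l z) * (S m * ((i == m)%:R - share m z)))
     + B * - (S l * S m * ((l == m)%:R * share l z - share l z * share m z)))) v
  = A * p ^+ 2 - B * q.
Proof.
move=> p q; rewrite quadE.
have -> : p ^+ 2 = \sum_l \sum_m (v l 0 * (S l * ((i == l)%:R - share l z)))
   * (v m 0 * (S m * ((i == m)%:R - share m z))) by rewrite sum_mul_sum.
have -> : q = \sum_l \sum_m (v l 0 * v m 0 *
    (S l * S m * ((l == m)%:R * share l z - share l z * share m z))).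
  rewrite /q expr2 -sum_mul_sum -sumrB; apply: eq_bigr => l _.
  have -> : share l z * (S l * v l 0) ^+ 2 =
    \sum_m v l 0 * v m 0 * (S l * S m * ((l == m)%:R * share l z)).
    rewrite (bigD1 l) //= big1 ?addr0 => [|m ml]; first by rewrite eqxx mul1r; ring.
    by rewrite eq_sym (negbTE ml) !(mul0r, mulr0).
  by rewrite -sumrB; apply: eq_bigr => m _; ring.
rewrite !mulr_sumr -sumrB; apply: eq_bigr => l _.
rewrite !mulr_sumr -sumrB; apply: eq_bigr => m _.
by rewrite mxE; ring.
Qed.

(** Shares lie in [0, 1], so every coefficient [(i == l)%:R - share l z] lies in [-1, 1]; the factor
    n is that of [sqr_sum_le]. *)
Lemma sqr_derive_log_sinr_le z v :
  (\sum_l v l 0 * (S l * ((i == l)%:R - share l z))) ^+ 2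
  <= n%:R * \sum_l (S l * v l 0) ^+ 2.
Proof.
apply: le_trans (sqr_sum_le _) _; rewrite ler_wpM2l //; apply: ler_sum => l _.
have := share_ge0 l z; have := share_le1 l z.
set c := (X in _ * (_ * X)); move=> s1 s0.
have c1 : c ^+ 2 <= 1.
  by rewrite /c; case: eqP => _ /=; nra.
have -> : (v l 0 * (S l * c)) ^+ 2 = c ^+ 2 * (S l * v l 0) ^+ 2 by ring.
by rewrite ler_piMl // sqr_ge0.
Qed.

(** Dropping the subtracted square and bounding shares by 1 already gives the sum without n; the
    factor n makes the bound match that of [sqr_derive_log_sinr_le]. *)
Lemma variance_share_le z v :
  \sum_l share l z * (S l * v l 0) ^+ 2 - (\sum_l share l z * (S l * v l 0)) ^+ 2
  <= n%:R * \sum_l (S l * v l 0) ^+ 2.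
Proof.
rewrite lerBlDr ler_wpDr ?sqr_ge0 //.
apply: (@le_trans _ _ (\sum_l (S l * v l 0) ^+ 2)).
  by apply: ler_sum => l _; rewrite ler_piMl ?sqr_ge0 // share_le1.
rewrite ler_peMl ?sumr_ge0 // => [l _|]; first exact: sqr_ge0.
(* The node [i] itself witnesses that n is at least 1. *)
by rewrite ler1n (leq_trans _ (ltn_ord i)).
Qed.

End LogSinr.

(** * Quasi-concavity of the SINR in the log-power variables *)

Section QuasiConcavity.
Context {R : realType} {n : nat}.
Variables (b S : 'I_n -> R) (N lnG : R) (i : 'I_n).
Hypotheses (b_ge0 : forall m, 0 <= b m) (N_gt0 : 0 < N).

Lemma convex_expR_real (lambda x y : R) : 0 <= lambda <= 1 ->
  expR (lambda * x + (1 - lambda) * y) <= lambda * expR x + (1 - lambda) * expR y.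
Proof.
move=> /andP[l0 l1]; set c := lambda * x + _.
(* The tangent at [c] lies below the exponential. Averaging its values at [x] and [y] returns
   [expR c], since [c] is their weighted mean. *)
have H z : expR c * (1 + (z - c)) <= expR z.
  by rewrite -[leRHS](_ : expR c * expR (z - c) = _) ?ler_wpM2l ?expR_ge0 ?expR_ge1Dx
    // -expRD addrC subrK.
have -> : expR c = lambda * (expR c * (1 + (x - c))) + (1 - lambda) * (expR c * (1 + (y - c))).
  by rewrite {3 5}/c; ring.
by rewrite lerD // ler_wpM2l ?subr_ge0.
Qed.

(** Dividing the received interference by the power of node [i] turns a superlevel set of the
    log-SINR into a sublevel set of a sum of exponentials of linear forms. *)
Lemma le_log_sinr t z : (t <= log_sinr b S N lnG i z) =
  (\sum_m b m * expR (z m 0 * S m - z i 0 * S i) + N * expR (- (z i 0 * S i))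
     <= expR (lnG - t)).
Proof.
have I0 : 0 < received b S N z by exact: received_gt0.
have -> : \sum_m b m * expR (z m 0 * S m - z i 0 * S i) + N * expR (- (z i 0 * S i))
    = expR (ln (received b S N z) - z i 0 * S i).
  rewrite expRD lnK // /received mulrDl mulr_suml; congr (_ + _).
  by apply: eq_bigr => m _; rewrite expRD mulrA.
by rewrite ler_expR /log_sinr; apply/idP/idP => H; lra.
Qed.

(* [1 / SINR] is a positive combination of exponentials of linear forms, hence
   convex; the statement follows by comparing it with [expR (- t)]. *)
Lemma log_sinr_quasi_concave (lambda t : R) (z0 z1 : 'cV[R]_n) : 0 <= lambda <= 1 ->
  t <= log_sinr b S N lnG i z0 -> t <= log_sinr b S N lnG i z1 ->
  t <= log_sinr b S N lnG i (lambda *: z0 + (1 - lambda) *: z1).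
Proof.
move=> l01; rewrite !le_log_sinr => H0 H1.
have -> : expR (lnG - t) = lambda * expR (lnG - t) + (1 - lambda) * expR (lnG - t) by ring.
have [l0 l1] := andP l01.
have := lerD (ler_wpM2l l0 H0) (ler_wpM2l (_ : 0 <= 1 - lambda) H1).
rewrite subr_ge0 => /(_ l1); apply: le_trans.
rewrite !mulrDr addrACA !mulr_sumr -big_split /=; apply: lerD.
  apply: ler_sum => m _; rewrite !mxE.
  have := ler_wpM2l (b_ge0 m) (convex_expR_real (z0 m 0 * S m - z0 i 0 * S i)
    (z1 m 0 * S m - z1 i 0 * S i) l01).
  rewrite (_ : lambda * _ + _ = (lambda * z0 m 0 + (1 - lambda) * z1 m 0) * S m
    - (lambda * z0 i 0 + (1 - lambda) * z1 i 0) * S i); last by ring.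
  by move=> H; apply: (le_trans H); rewrite le_eqVlt; apply/orP; left; apply/eqP; ring.
rewrite !mxE.
have := ler_wpM2l (ltW N_gt0) (convex_expR_real (- (z0 i 0 * S i)) (- (z1 i 0 * S i)) l01).
rewrite (_ : lambda * _ + _ = - ((lambda * z0 i 0 + (1 - lambda) * z1 i 0) * S i)); last by ring.
by move=> H; apply: (le_trans H); rewrite le_eqVlt; apply/orP; left; apply/eqP; ring.
Qed.

End QuasiConcavity.

(** * The cost of one link as a function of its log-SINR *)

Section Link.
Context {R : realType}.
Variables (d : R * R -> R) (F : R) (C : R -> R).
Hypotheses (hd : link_cost d) (hC : capacity C) (F_ge0 : 0 <= F).

Lemma capacity_derive1_ge0 x : 0 < x -> 0 <= derive1 C x.
Proof.
move=> x0; apply: (@incr_derive1_ge0_itvy _ _ false 0).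
- by move=> y; rewrite inE /= in_itv /= andbT => /(capacity_C2 hC)[].
- move=> y z; rewrite !in_itv /= !andbT => y0 z0; exact: capacity_incr.
- by rewrite in_itv /= andbT.
Qed.

Lemma capacity_le x y : 0 < x -> x <= y -> C x <= C y.
Proof.
move=> x0; rewrite le_eqVlt => /orP[/eqP -> //|xy].
exact/ltW/capacity_incr.
Qed.

Lemma is_derive_link_cost c : F < c ->
  is_derive c 1 (fun c' => d (c', F)) (dC d (c, F)).
Proof.
move=> Fc; have [U [_ fU [C1 _ _]]] := link_cost_C2 hd.
have fcF : feasible (c, F) by rewrite /feasible /= F_ge0.
by have [/derivableP D _ _ _] := C1 (c, F) (fU _ fcF); exact/is_derive_fst.
Qed.

Lemma is_derive_dC c : F < c ->
  is_derive c 1 (fun c' => dC d (c', F)) (dC (dC d) (c, F)).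
Proof.
move=> Fc; have [U [_ fU [_ C1 _]]] := link_cost_C2 hd.
have fcF : feasible (c, F) by rewrite /feasible /= F_ge0.
by have [/derivableP D _ _ _] := C1 (c, F) (fU _ fcF); exact/is_derive_fst.
Qed.

Lemma link_cost_nincr c1 c2 : F < c1 -> c1 <= c2 -> d (c2, F) <= d (c1, F).
Proof.
move=> Fc1; have D c : c1 <= c -> is_derive c 1 (fun c' => d (c', F)) (dC d (c, F)).
  by move=> c1c; apply: is_derive_link_cost; exact: lt_le_trans c1c.
apply: (@ler0_derive1_nincry _ (fun c => d (c, F)) c1) => //.
- by move=> c; rewrite in_itv /= andbT => /ltW/D[].
- move=> c; rewrite in_itv /= andbT => c1c.
  rewrite derive1E; have [_ ->] := D _ (ltW c1c).
  by apply/ltW/(link_cost_dC hd); rewrite /feasible /= F_ge0 (lt_trans Fc1).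
- apply: derivable_within_continuous => c; rewrite in_itv /= andbT => /D[] //.
Qed.

Definition log_cost t := d (C (expR t), F).
Definition log_cost1 t :=
  dC d (C (expR t), F) * (derive1 C (expR t) * expR t).
(** The second derivative of [log_cost], grouped so that the factor of [dC d] is C'' x^2 + C' x at x
    = e^t, whose sign is given by [capacity_elastic]. *)
Definition log_cost2 t :=
  dC (dC d) (C (expR t), F) * (derive1 C (expR t) * expR t) ^+ 2
  + dC d (C (expR t), F)
    * (derive1 (derive1 C) (expR t) * expR t ^+ 2 + derive1 C (expR t) * expR t).

Lemma is_derive_cap_expR t :
  is_derive (t : R) (1 : R) (C \o expR) (derive1 C (expR t) * expR t).
Proof.
have [C1 _ _] := capacity_C2 hC (expR_gt0 t).
exact: is_derive1_comp (is_derive1E C1) (is_derive_expR t).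
Qed.

Lemma is_derive_log_cost t : F < C (expR t) -> is_derive (t : R) (1 : R) log_cost (log_cost1 t).
Proof.
move=> Ft; exact: (is_derive1_comp (is_derive_link_cost Ft) (is_derive_cap_expR t)).
Qed.

Lemma is_derive_log_cost1 t : F < C (expR t) ->
  is_derive (t : R) (1 : R) log_cost1 (log_cost2 t).
Proof.
move=> Ft; have [_ C2 _] := capacity_C2 hC (expR_gt0 t).
have d1 : is_derive t 1 (fun s => dC d (C (expR s), F)) _ :=
  is_derive1_comp (is_derive_dC Ft) (is_derive_cap_expR t).
have d2 : is_derive t 1 (fun s => derive1 C (expR s)) _ :=
  is_derive1_comp (is_derive1E C2) (is_derive_expR t).
have d3 : is_derive t 1 (fun s => derive1 C (expR s) * expR s) _ :=
  is_deriveM d2 (is_derive_expR t).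
apply: is_derive_eq (is_deriveM d1 d3) _.
rewrite /GRing.scale /= /log_cost2 /comp; ring.
Qed.

Lemma near_feasible_log t : F < C (expR t) -> \forall s \near (t : R), F < C (expR s).
Proof.
move=> Ft; have cC : {for t, continuous (C \o expR)}.
  apply: differentiable_continuous.
  by apply/derivable1_diffP; have [] := is_derive_cap_expR t.
exact: (cvgr_gt _ cC _ Ft).
Qed.

End Link.

(** Here [h1] and [h2] stand for D_C and D_CC, and [W] bounds both p^2 and q. The weights a - X and
    X are nonnegative with sum a, so (a - X) p^2 + X q <= a W. The product of the two nonpositive
    bounds [Bl] and [ph] then dominates - h1 a. *)
Lemma link_quad_le (R : realFieldType) (h1 h2 X a p2 q W Bu Bl kap ph : R) :
  h1 <= 0 -> 0 <= h2 -> 0 <= X -> X <= a -> 0 <= p2 -> p2 <= W -> q <= W ->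
  h2 <= Bu -> Bl <= h1 -> X ^+ 2 <= kap -> ph <= - a ->
  (h2 * X ^+ 2 + h1 * (- a + X)) * p2 - h1 * X * q <= (Bu * kap + Bl * ph) * W.
Proof.
move=> h1n h2p Xp Xa p0 pW qW hB Bh Xk pha.
have W0 : 0 <= W by exact: le_trans pW.
have b1 : h2 * X ^+ 2 * p2 <= Bu * kap * W.
  by rewrite ler_pM ?mulr_ge0 ?sqr_ge0 // ler_pM ?sqr_ge0.
have b2 : (a - X) * p2 + X * q <= a * W.
  have -> : a * W = (a - X) * W + X * W by ring.
  by rewrite lerD // ler_wpM2l ?subr_ge0.
have b3 : - h1 * ((a - X) * p2 + X * q) <= - h1 * (a * W).
  by rewrite ler_wpM2l ?oppr_ge0.
have b4 : - h1 * (a * W) <= Bl * ph * W.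
  rewrite mulrA ler_wpM2r // -[Bl * ph]mulrNN.
  by rewrite ler_pM ?oppr_ge0 ?lerN2 ?(le_trans Xp) // lerNr.
by nra.
Qed.

(** * From single links to the Hessian of the network cost *)

Section NetworkHessian.
Context {R : realType} {n : nat}.
Variables (net : network R n) (eta F : 'I_n -> 'I_n -> R).
Hypotheses (hnet : network_axioms net) (heta : allocation net eta).
Implicit Types (i j m : 'I_n) (z v : 'cV[R]_n).

Notation S := (log_pmax net).

(** Absorbs the self-interference of node [i], damped by [1 - eta i j], into one sum over all
    nodes. *)
Definition coupling i j m : R :=
  gain net m j * (if m == i then 1 - eta i j else 1).

Lemma allocation_le1 i j : edge net i j -> eta i j <= 1.
Proof.
move=> eij; have [eta0 eta1] := heta; rewrite -(eta1 i); last by exists j.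
by rewrite (bigD1 j) //= lerDl sumr_ge0 // => k /andP[/eta0].
Qed.

Lemma coupling_ge0 i j m : edge net i j -> 0 <= coupling i j m.
Proof.
move=> eij; rewrite mulr_ge0 //; first exact: gain_ge0.
by case: ifP => // _; rewrite subr_ge0 allocation_le1.
Qed.

Lemma power_expR z m : power net z m = expR (z m 0 * S m).
Proof.
rewrite /power /powR gt_eqF //.
exact: lt_trans (pmax_gt1 hnet m).
Qed.

Lemma interference_received z i j :
  interference net (power net z) eta i j = received (coupling i j) S (noise net j) z.
Proof.
rewrite /interference /received [in RHS](bigD1 i) //= /coupling eqxx; congr (_ + _ + _).
  by rewrite power_expR; ring.
by apply: eq_bigr => m /negbTE ->; rewrite power_expR mulr1.
Qed.

Lemma sinr_expR z i j : edge net i j -> 0 < gain net i j * eta i j ->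
  sinr net (power net z) eta i j =
  expR (log_sinr (coupling i j) S (noise net j) (ln (gain net i j * eta i j)) i z).
Proof.
move=> eij a0.
have I0 := received_gt0 S (fun m => coupling_ge0 m eij) (noise_gt0 hnet j) z.
rewrite /sinr interference_received power_expR /log_sinr expRD expRN !expRD !lnK //.
by ring.
Qed.

Lemma sinr_eq0 z i j : gain net i j * eta i j = 0 -> sinr net (power net z) eta i j = 0.
Proof. by move=> a0; rewrite /sinr mulrCA a0 mulr0 mul0r. Qed.

(** The logarithm of the SINR is meaningful only in the second case; in the first the SINR vanishes
    for every power vector. *)
Lemma gain_alloc_cases i j : edge net i j ->
  gain net i j * eta i j = 0 \/ 0 < gain net i j * eta i j.
Proof.
move=> eij; have := mulr_ge0 (gain_ge0 hnet i j) (heta.1 i j eij).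
by rewrite le_eqVlt => /orP[/eqP|]; [left|right].
Qed.

Lemma power_le z m : admissible z -> 0 <= power net z m <= pmax net m.
Proof.
move=> adm; rewrite powR_ge0 /=; have p1 := ltW (pmax_gt1 hnet m).
by rewrite -[leRHS]powRr1 ?(le_trans _ p1) // ler_powR.
Qed.

Definition operating_point z i j : R * R :=
  (cap net (sinr net (power net z) eta i j), F i j).

Definition within_budget (D0 : R) z : Prop := forall i j, edge net i j ->
  feasible (operating_point z i j) /\ lcost net i j (operating_point z i j) <= D0.

(** Link costs are nonnegative, so each is at most the total; a finite total excludes the value +oo
    and hence forces feasibility. *)
Lemma network_cost_budget D0 z :
  (network_cost net eta F z <= D0%:E)%E -> within_budget D0 z.
Proof.
move=> cost i j eij.
have ext0 i' j' : edge net i' j' ->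
    (0 <= ext_cost (lcost net i' j') (operating_point z i' j'))%E.
  move=> e; rewrite /ext_cost; case: ifPn => // /set_mem fp.
  by rewrite lee_fin (link_cost_ge0 (lcost_axioms hnet e)).
have : (ext_cost (lcost net i j) (operating_point z i j) <= D0%:E)%E.
  apply: le_trans cost; rewrite /network_cost (bigD1 (i, j)) /=; last by rewrite inE.
  rewrite leeDl // sume_ge0 // => -[i' j'] /andP[]; rewrite inE /= => e _.
  exact: ext0.
by rewrite /ext_cost; case: ifPn => // /set_mem fp; rewrite lee_fin.
Qed.

Lemma within_budget_segment D0 (lambda : R) z0 z1 : 0 <= lambda <= 1 ->
  within_budget D0 z0 -> within_budget D0 z1 ->
  within_budget D0 (lambda *: z0 + (1 - lambda) *: z1).
Proof.
move=> l01 b0 b1 i j eij; have [f0 d0] := b0 i j eij; have [f1 d1] := b1 i j eij.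
have [a0|a0] := gain_alloc_cases eij.
  by move: f0 d0; rewrite /operating_point !sinr_eq0.
set y := log_sinr (coupling i j) S (noise net j) (ln (gain net i j * eta i j)) i.
(* Raising the log-SINR raises the capacity, which preserves feasibility and cannot increase the
   cost. *)
have lcap u z : u <= y z ->
    feasible (cap net (expR u), F i j) -> lcost net i j (cap net (expR u), F i j) <= D0 ->
    feasible (cap net (expR (y z)), F i j) /\
    lcost net i j (cap net (expR (y z)), F i j) <= D0.
  move=> uy /= /andP[F0 Fu] du.
  have cuy : cap net (expR u) <= cap net (expR (y z)).
    by apply: (capacity_le (cap_axioms hnet)); rewrite ?expR_gt0 ?ler_expR.
  split; first by rewrite /feasible /= F0 (lt_le_trans Fu).
  by apply: le_trans du; apply: (link_cost_nincr (lcost_axioms hnet eij)).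
have Ey z : sinr net (power net z) eta i j = expR (y z) by exact: sinr_expR.
move: f0 d0 f1 d1; rewrite /operating_point !Ey => f0 d0 f1 d1.
have qc t : t <= y z0 -> t <= y z1 -> t <= y (lambda *: z0 + (1 - lambda) *: z1).
  by apply: log_sinr_quasi_concave => //; [move=> m; exact: coupling_ge0|exact: noise_gt0].
(* Compare with the endpoint of smaller SINR, the costlier one for this link. *)
have [y01|/ltW y10] := leP (y z0) (y z1).
  by apply: (lcap (y z0)) => //; exact: qc.
by apply: (lcap (y z1)) => //; exact: qc.
Qed.

(** Feasibility around [z], not only at it, will identify [ext_cost] with the real cost when
    differentiating. *)
Lemma link_hessian D0 xbar z v i j : sinr_bound net xbar -> finite_extrema net D0 xbar ->
  admissible z -> within_budget D0 z -> edge net i j ->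
  exists gH : ('I_n -> R) * 'M[R]_n,
  [/\ has_hessian (fun z' => lcost net i j (operating_point z' i j)) z gH.1 gH.2,
      \forall z' \near z, feasible (operating_point z' i j)
    & quad gH.2 v <= (Bmax net D0 * kappa net xbar + Bmin net D0 * phi net xbar)
        * (n%:R * \sum_m (S m * v m 0) ^+ 2)].
Proof.
move=> hx [hBu hBl hk hp] adm bz eij; have [fz dz] := bz i j eij.
have hd := lcost_axioms hnet eij; have hC := cap_axioms hnet.
have W0 : 0 <= n%:R * \sum_m (S m * v m 0) ^+ 2.
  by rewrite mulr_ge0 // sumr_ge0 // => m _; exact: sqr_ge0.
set x := sinr net (power net z) eta i j.
have xx : x <= xbar by apply: hx => // m; exact: power_le.
have Bu : dC (dC (lcost net i j)) (operating_point z i j) <= Bmax net D0.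
  by apply: ub_le_sup => //; exists i, j, (operating_point z i j).
have Bl : Bmin net D0 <= dC (lcost net i j) (operating_point z i j).
  by apply: ge_inf => //; exists i, j, (operating_point z i j).
have kx : 0 <= x -> (derive1 (cap net) x * x) ^+ 2 <= kappa net xbar.
  move=> x0; rewrite exprMn; apply: ub_le_sup => //; exists x => //=.
  by rewrite in_itv /= x0.
have px : 0 <= x -> phi net xbar <= derive1 (derive1 (cap net)) x * x ^+ 2.
  move=> x0; apply: ge_inf => //; exists x => //=.
  by rewrite in_itv /= x0.
have h2 := link_cost_dCC hd fz; have h1 := ltW (link_cost_dC hd fz).
have [a0|a0] := gain_alloc_cases eij.
  have E z' : operating_point z' i j = operating_point z i j.
    by rewrite /operating_point !sinr_eq0.
  exists (fun=> 0, 0); split => /=.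
  - by under eq_fun do rewrite E; exact: has_hessian_cst.
  - by near=> z'; rewrite E.
  (* The Hessian is zero, so the bound must be nonnegative. The values at x = 0 give kappa >= 0 and
     phi <= 0, while Bmax >= 0 and Bmin <= 0 come from the signs of D_CC and D_C. *)
  - have xe : x = 0 by exact: sinr_eq0.
    rewrite {1}/quad mulmx0 mul0mx mxE mulr_ge0 //.
    move: kx px; rewrite xe mulr0 !expr0n /= mulr0 => /(_ (lexx _)) k0 /(_ (lexx _)) p0.
    apply: addr_ge0; first by rewrite mulr_ge0 // (le_trans h2).
    by rewrite -mulrNN mulr_ge0 ?oppr_ge0 // (le_trans Bl).
pose lnG := ln (gain net i j * eta i j).
have b0 m := coupling_ge0 m eij; have N0 := noise_gt0 hnet j.
pose y := log_sinr (coupling i j) S (noise net j) lnG i.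
have Ey z' : sinr net (power net z') eta i j = expR (y z') by exact: sinr_expR.
have [/andP[F0 Fy]] : feasible (cap net (expR (y z)), F i j).
  by rewrite -Ey.
rewrite /= in F0 Fy.
have cy : {for z, continuous y} by exact: continuous_log_sinr.
have nearF : \forall t \near y z, F i j < cap net (expR t) by exact: near_feasible_log.
exists (fun l => log_cost1 (lcost net i j) (F i j) (cap net) (y z) *
   (S l * ((i == l)%:R - share (coupling i j) S (noise net j) l z)),
 \matrix_(l, m)
    (log_cost2 (lcost net i j) (F i j) (cap net) (y z) *
      (S l * ((i == l)%:R - share (coupling i j) S (noise net j) l z)
       * (S m * ((i == m)%:R - share (coupling i j) S (noise net j) m z)))
     + log_cost1 (lcost net i j) (F i j) (cap net) (y z)
       * - (S l * S m * ((l == m)%:R * share (coupling i j) S (noise net j) l z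
            - share (coupling i j) S (noise net j) l z
              * share (coupling i j) S (noise net j) m z)))).
split => /=.
- under eq_fun do rewrite /operating_point Ey.
  apply: has_hessian_eq (has_hessian_comp cy (has_hessian_log_sinr S lnG i b0 N0 z)
    (filterS (fun t => @is_derive_log_cost _ _ _ _ hd hC F0 t) nearF)
    (is_derive_log_cost1 hd hC F0 Fy)) _.
  by apply/matrixP => l m; rewrite !mxE.
- have : \forall z' \near z, F i j < cap net (expR (y z')) by exact: cy nearF.
  by apply: filterS => z' ?; rewrite /operating_point Ey /feasible /= F0.
- rewrite quad_log_sinr_comp /log_cost1 /log_cost2 -Ey -/x.
  have x0 : 0 < x by rewrite /x Ey expR_gt0.
  (* Presents C'' x^2 as - a with a = - C'' x^2, the shape [link_quad_le] expects. *)
  rewrite -[X in _ * (X + _)]opprK.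
  apply: link_quad_le => //.
  + by rewrite mulr_ge0 ?(ltW x0) // capacity_derive1_ge0.
  (* Multiplied by x, the elasticity condition reads X <= a. *)
  + have := ler_wpM2r (ltW x0) (capacity_elastic hC x0); nra.
  + exact: sqr_ge0.
  + exact: sqr_derive_log_sinr_le.
  + exact: variance_share_le.
  + exact/kx/ltW.
  + by rewrite opprK; exact/px/ltW.
Unshelve. all: by end_near. Qed.

(** The Hessian is the sum of the link Hessians: the number of links gives one factor of [Vbar], and
    the n in each link bound the other. *)
Lemma hessian_cost_le D0 xbar z v : sinr_bound net xbar -> finite_extrema net D0 xbar ->
  admissible z -> within_budget D0 z ->
  quad (hessian_cost net eta F z) v <= quad (Vbar net D0 xbar) v.
Proof.
move=> hx hfin adm bz.
have /choice[gH hgH] (e : 'I_n * 'I_n) : exists gH : ('I_n -> R) * 'M[R]_n,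
  e \in edge_set net ->
  [/\ has_hessian (fun z' => lcost net e.1 e.2 (operating_point z' e.1 e.2)) z gH.1 gH.2,
      \forall z' \near z, feasible (operating_point z' e.1 e.2)
    & quad gH.2 v <= (Bmax net D0 * kappa net xbar + Bmin net D0 * phi net xbar)
        * (n%:R * \sum_m (S m * v m 0) ^+ 2)].
  (* Off the edge set any pair serves, so the choice function can be total. *)
  have [|ne] := boolP (e \in edge_set net); last by exists (fun=> 0, 0).
  by rewrite inE => /(link_hessian v hx hfin adm bz)[gH ?]; exists gH.
have nearE : \forall z' \near z, forall e, e \in edge_set net ->
    feasible (operating_point z' e.1 e.2).
  (* There are finitely many pairs of nodes, so one neighbourhood serves all links. *)
  apply: (@filter_forall _ _ (fun e z' => e \in edge_set net ->
    feasible (operating_point z' e.1 e.2)) (nbhs z) _) => e.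
  have [/hgH[_ fe _]|ne] := boolP (e \in edge_set net).
    by apply: filterS fe => z' fz' _.
  by near=> z' => eE; case/negP: ne.
have hH e (eE : e \in edge_set net) : has_hessian
    (fun z' => lcost net e.1 e.2 (operating_point z' e.1 e.2)) z (gH e).1 (gH e).2.
  by have [] := hgH e eE.
have H := has_hessian_sum hH.
rewrite /hessian_cost (has_hessianE (has_hessian_near _ H)); last first.
  (* Near [z] every extended cost is finite, so [fine] of the sum is the real sum of the link
     costs. *)
  apply: filterS nearE => z' fz' /=; rewrite /network_cost.
  rewrite (eq_bigr (fun e => (lcost net e.1 e.2 (operating_point z' e.1 e.2))%:E)).
    by rewrite sumEFin.
  by move=> e /fz' fe; rewrite /ext_cost mem_set.
rewrite quad_sum /Vbar quad_scale_diag card_ord.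
have hle e (eE : e \in edge_set net) : quad (gH e).2 v <=
    (Bmax net D0 * kappa net xbar + Bmin net D0 * phi net xbar)
      * (n%:R * \sum_m (S m * v m 0) ^+ 2).
  by have [] := hgH e eE.
apply: (le_trans (ler_sum _ hle)).
rewrite sumr_const -mulr_natl le_eqVlt; apply/orP; left; apply/eqP.
under eq_bigr do rewrite exprMn.
by ring.
Unshelve. all: by end_near. Qed.

End NetworkHessian.

(** * The bound on the segment between two iterates *)

Theorem lemma4 (R : realType) (n : nat) (net : network R n)
    (hnet : network_axioms net)
    (eta F : 'I_n -> 'I_n -> R) (heta : allocation net eta)
    (D0 xbar : R) (hxbar : sinr_bound net xbar)
    (hfin : finite_extrema net D0 xbar)
    (V : nat -> 'M[R]_n) (hV : forall k, sym_posdef (V k))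
    (gamma : nat -> 'cV[R]_n)
    (hgamma0 : admissible (gamma 0%N))
    (hstep : forall k,
       power_control_step net eta F (V k) (gamma k) (gamma k.+1))
    (hinit : (network_cost net eta F (gamma 0%N) <= D0%:E)%E)
    (k : nat)
    (hcost : (network_cost net eta F (gamma k)
                <= network_cost net eta F (gamma 0%N))%E)
    (hcost' : (network_cost net eta F (gamma k.+1)
                 <= network_cost net eta F (gamma 0%N))%E)
    (lambda : R) (hlambda : 0 <= lambda <= 1) (v : 'cV[R]_n) :
  quad (hessian_cost net eta F
          (lambda *: gamma k + (1 - lambda) *: gamma k.+1)) v
  <= quad (Vbar net D0 xbar) v.
Proof.
have adm l : admissible (gamma l).
  by case: l => [|l] //; case: (hstep l).
have budget l : (network_cost net eta F (gamma l)
    <= network_cost net eta F (gamma 0%N))%E -> within_budget net eta F D0 (gamma l).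
  by move=> cl; apply: network_cost_budget (le_trans cl hinit).
apply: hessian_cost_le => //; last by apply: within_budget_segment => //; apply: budget.
have /andP[l0 l1] := hlambda; move=> i; rewrite !mxE.
by have := adm k i; have := adm k.+1 i; nra.
Qed.
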